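(* Let $\mathcal E_{\mathrm t}=\mathbb V\{\hat\alpha_{ij}-\rho(\bm c_{ij})\}$ be the variance of the interpolation error of the joint multi-band local polynomial estimator described in the context, for a source with power spectrum $\bm\Phi=(\phi_1,\dots,\phi_K)$, and let $C=C(\{\bm z_m\},b)$ be the constant described there. The signal-to-noise ratio (SNR) is $1/\sigma_\epsilon^2$. At high SNR, the uniform spectrum $\bm\Phi=(1,1,\dots,1)$ asymptotically minimizes $\mathcal E_{\mathrm t}$ as $1/\sigma_\epsilon^2\to\infty$, and consequently, $\mathcal E_{\mathrm t}\to C\sigma_\eta^2/K$. At low SNR, the single band measurement under $\bm\Phi=(K,0,0,\dots,0)$ asymptotically minimizes $\mathcal E_{\mathrm t}$ as $1/\sigma_\epsilon^2\to0$, and consequently, $\mathcal E_{\mathrm t}\to C\sigma_\epsilon^2/K^2$.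
   Context: Single source, $K$ frequency bands, bounded area $\mathcal D\subseteq\mathbb R^2$. The power of the source in band $k$ at location $\bm z$ is $\rho_k(\bm z)=(\rho(\bm z)+\eta_k(\bm z))\phi_k$, where $\rho$ is the large-scale propagation field (path gain plus shadowing), $\eta_k(\bm z)\sim\mathcal N(0,\sigma_\eta^2)$ is frequency-selective fading, and $\phi_k\ge0$ is the power allocated to band $k$, with $\sum_{k=1}^K\phi_k=K$. The field $\rho_k$ is assumed third-order differentiable. Sensors at $\bm z_1,\dots,\bm z_M\in\mathcal D$ each measure all $K$ bands: $\gamma_m^{(k)}=\rho_k(\bm z_m)+\epsilon$, where $\epsilon\sim\mathcal N(0,\sigma_\epsilon^2)$ is measurement noise. Fading and noise are independent of each other and across measurements. The spectrum $\bm\Phi$ is available to the estimator. Estimator: for a grid point $\bm c_{ij}\in\mathcal D$, kernel $\kappa$ and window size $b$, $\hat\alpha_{ij}$ is the $\alpha$-component of the solution $(\alpha,\bm\beta,\bm B)\in\mathbb R\times\mathbb R^2\times\mathbb R^{2\times2}$ of the weighted least-squares problem of minimizing $$\sum_{m=1}^M\sum_{k=1}^K\Big(\gamma_m^{(k)}-\phi_k\big[\alpha+\bm\beta^{\mathrm T}(\bm z_m-\bm c_{ij})+(\bm z_m-\bm c_{ij})^{\mathrm T}\bm B(\bm z_m-\bm c_{ij})\big]\Big)^2\kappa\Big(\frac{\bm z_m-\bm c_{ij}}b\Big).$$ Constant: $C(\{\bm z_m\},b)$ depends on the sensor locations and the window size; explicitly $C=[\bm A_1^{-1}\bm A_2\bm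 A_1^{-1}]_{(1,1)}$, where $\bm A_1=\sum_m\kappa_m\bm x_m\bm x_m^{\mathrm T}$ is assumed invertible, $\bm A_2=\sum_m\kappa_m^2\bm x_m\bm x_m^{\mathrm T}$, $\kappa_m=\kappa((\bm z_m-\bm c_{ij})/b)$, and $\bm x_m=[1,(\bm z_m-\bm c_{ij})^{\mathrm T},\mathrm{vec}((\bm z_m-\bm c_{ij})(\bm z_m-\bm c_{ij})^{\mathrm T})^{\mathrm T}]^{\mathrm T}\in\mathbb R^7$.
   Formalization: A_1 is always singular (vec repeats a product), so ''A_1 invertible'' is replaced by rank A_1 at least 6, with a generalized inverse in C; the low-SNR limit E_t → Cσ_ε²/K² is read as ratio tending to 1, and σ_η > 0 is assumed. *)

(* Defs.v *)
(* MathComp / MathComp-Analysis *)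
From mathcomp Require Export all_boot all_order all_algebra.
From mathcomp Require Export all_classical all_reals all_analysis.

Set Implicit Arguments.
Unset Strict Implicit.
Unset Printing Implicit Defensive.

Import Order.TTheory GRing.Theory Num.Theory.
Import numFieldNormedType.Exports.

Local Open Scope classical_set_scope.
Local Open Scope ring_scope.

(* Fields on the area are total functions on the plane. Third order
   differentiability at z requires f to be twice differentiable around z and
   every second order directional derivative to be differentiable at z; in
   finite dimension this is equivalent to iterated Frechet differentiability. *)
Definition third_order_differentiable (R : realType)
    (f : 'cV[R]_2 -> R^o) (z : 'cV[R]_2) : Prop :=
  (\forall y \near z, differentiable f y /\
     forall v : 'cV[R]_2, differentiable ('D_v f) y) /\
  (forall v w : 'cV[R]_2, differentiable ('D_w ('D_v f)) z).

(* The family is finite, so the product rules for its subfamilies are the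
   instances where some of the A i are the whole line. *)
Definition mutually_independent d (T : measurableType d) (R : realType)
    (P : probability T R) (I : finType) (X : I -> T -> R) : Prop :=
  forall A : I -> set R, (forall i, measurable (A i)) ->
    P [set w | forall i, A i (X i w)] = (\prod_(i : I) P (X i @^-1` A i))%E.

Section Model.
Variables (R : realType) (K M : nat).
Implicit Type phi : 'I_K -> R.

Definition spectrum phi : Prop :=
  (forall k, 0 <= phi k) /\ \sum_(k < K) phi k = K%:R.

Definition uniform_spectrum : 'I_K -> R := fun=> 1.

Definition single_band_spectrum : 'I_K -> R :=
  fun k => if val k == 0%N then K%:R else 0.

(* eta is a realization of the fading fields and eps one of the noises. *)
Definition band_power (rho : 'cV[R]_2 -> R) (eta : 'I_K -> 'cV[R]_2 -> R)
    phi (k : 'I_K) (z : 'cV[R]_2) : R :=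
  (rho z + eta k z) * phi k.

Definition measurement (rho : 'cV[R]_2 -> R) (eta : 'I_K -> 'cV[R]_2 -> R)
    (eps : 'I_M -> 'I_K -> R) (z : 'I_M -> 'cV[R]_2) phi
    (m : 'I_M) (k : 'I_K) : R :=
  band_power rho eta phi k (z m) + eps m k.

Definition fading_and_noise (Omega : Type)
    (eta : 'I_K -> 'cV[R]_2 -> Omega -> R) (eps : 'I_M -> 'I_K -> Omega -> R)
    (z : 'I_M -> 'cV[R]_2)
    (i : ('I_M * 'I_K) + ('I_M * 'I_K)) : Omega -> R :=
  match i with
  | inl (m, k) => eta k (z m)
  | inr (m, k) => eps m k
  end.

Section Estimator.
Variables (kappa : 'cV[R]_2 -> R) (b : R) (z : 'I_M -> 'cV[R]_2).
Variable c : 'cV[R]_2.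

Definition kernel_weight (m : 'I_M) : R := kappa (b^-1 *: (z m - c)).

Definition wls_loss phi (gamma : 'I_M -> 'I_K -> R)
    (alpha : R) (beta : 'cV[R]_2) (B : 'M[R]_2) : R :=
  \sum_(m < M) \sum_(k < K)
    (gamma m k - phi k * (alpha + (beta^T *m (z m - c)) 0 0
                          + ((z m - c)^T *m B *m (z m - c)) 0 0)) ^+ 2
    * kernel_weight m.

(* The minimizing B is never unique, since only its symmetric part matters. *)
Definition wls_alpha phi (gamma : 'I_M -> 'I_K -> R) (alpha : R) : Prop :=
  exists (beta : 'cV[R]_2) (B : 'M[R]_2), forall alpha' beta' B',
    wls_loss phi gamma alpha beta B <= wls_loss phi gamma alpha' beta' B'.

Definition regressor (m : 'I_M) : 'cV[R]_(1 + (2 + 2 * 2)) :=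
  col_mx 1%:M (col_mx (z m - c) (mxvec ((z m - c) *m (z m - c)^T))^T).

Definition gram1 : 'M[R]_(1 + (2 + 2 * 2)) :=
  \sum_(m < M) kernel_weight m *: (regressor m *m (regressor m)^T).

Definition gram2 : 'M[R]_(1 + (2 + 2 * 2)) :=
  \sum_(m < M) kernel_weight m ^+ 2 *: (regressor m *m (regressor m)^T).

(* [A1^-1 A2 A1^-1]_(1,1). The vector vec (d d^T) lists the product of the two
   coordinates of d twice, so A1 is never a unit (gram1_nunit) and its rank is
   at most 6. The inverse is therefore the partial inverse pinvmx, which is
   invmx on units; when A1 has rank 6 any generalized inverse yields the same
   value (variance_constE). *)
Definition variance_const : R := (pinvmx gram1 *m gram2 *m pinvmx gram1) 0 0.

Let redundancy : 'rV[R]_(1 + (2 + 2 * 2)) :=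
  row_mx 0 (row_mx 0 (mxvec (delta_mx 0 1 - delta_mx 1 0))).

Let redundancy_neq0 : redundancy != 0.
Proof.
apply/eqP => /(congr1 rsubmx); rewrite row_mxKr linear0 => /(congr1 rsubmx).
rewrite row_mxKr linear0 => /(congr1 vec_mx); rewrite mxvecK linear0.
move=> /matrixP /(_ 0 1); rewrite !mxE /= subr0 => /eqP.
by rewrite oner_eq0.
Qed.

Let mulmx_skew0 n (u : 'rV[R]_n) (i j : 'I_n) :
  u *m (delta_mx i j - delta_mx j i) *m u^T = 0.
Proof.
rewrite mulmxBr mulmxBl; apply/eqP; rewrite subr_eq0; apply/eqP.
transitivity ((u *m delta_mx j i *m u^T)^T).
  by rewrite !trmx_mul trmxK trmx_delta mulmxA.
by apply/matrixP => k l; rewrite !ord1 mxE.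
Qed.

Let redundancy_regressor m : redundancy *m regressor m = 0.
Proof.
rewrite /redundancy /regressor !mul_row_col !mul0mx !add0r.
have -> (u v : 'rV[R]_(2 * 2)) : u *m v^T = v *m u^T.
  by apply/matrixP => i j; rewrite !ord1 -[u in LHS]trmxK -trmx_mul mxE.
set S := (_ - _ : 'M[R]_2); set u := (z m - c)^T.
have -> : z m - c = u^T by rewrite /u trmxK.
rewrite mxvec_dotmul; exact: mulmx_skew0.
Qed.

Let redundancy_gram (a : 'I_M -> R) :
  redundancy *m (\sum_m a m *: (regressor m *m (regressor m)^T)) = 0.
Proof.
rewrite mulmx_sumr big1 // => m _.
by rewrite -scalemxAr mulmxA redundancy_regressor mul0mx scaler0.
Qed.

Let gram_sym (a : 'I_M -> R) :
  (\sum_m a m *: (regressor m *m (regressor m)^T))^T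
    = \sum_m a m *: (regressor m *m (regressor m)^T).
Proof.
by rewrite linear_sum; apply: eq_bigr => m _; rewrite linearZ /= trmx_mul trmxK.
Qed.

Lemma gram1_nunit : gram1 \notin unitmx.
Proof.
apply/negP => A1u; move/eqP: redundancy_neq0; apply.
by rewrite -[redundancy](mulmxK A1u) redundancy_gram mul0mx.
Qed.

Lemma variance_constE (G : 'M[R]_(1 + (2 + 2 * 2))) :
  (6 <= \rank gram1)%N -> gram1 *m G *m gram1 = gram1 ->
  (G *m gram2 *m G) 0 0 = variance_const.
Proof.
move=> rk6.
have A1r : gram1 *m redundancy^T = 0.
  by rewrite -[gram1]gram_sym -trmx_mul redundancy_gram trmx0.
have A2r : gram2 *m redundancy^T = 0.
  by rewrite -[gram2]gram_sym -trmx_mul redundancy_gram trmx0.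
have sA1 : (gram1 <= kermx redundancy^T)%MS by apply/sub_kermxP.
have rkK : \rank (kermx redundancy^T) = 6.
  by rewrite mxrank_ker mxrank_tr rank_rV redundancy_neq0.
have sK : (kermx redundancy^T <= gram1)%MS.
  rewrite -(geq_leqif (mxrank_leqif_sup sA1)) rkK //.
have /submxP[Y A2Y] : (gram2 <= gram1)%MS.
  by apply: submx_trans sK; apply/sub_kermxP.
have A2Y' : gram2 = gram1 *m Y^T.
  by rewrite -[gram2]gram_sym -/gram2 {1}A2Y trmx_mul [gram1^T]gram_sym.
pose Z := Y^T *m pinvmx gram1.
have A2Z : gram2 = gram1 *m Z *m gram1.
  rewrite /Z mulmxA -A2Y' mulmxKpV //.
  by apply: submx_trans sK; apply/sub_kermxP.
pose e : 'rV[R]_(1 + (2 + 2 * 2)) := delta_mx 0 0.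
have /submxP[u eu] : (e <= gram1)%MS.
  apply: submx_trans sK; apply/sub_kermxP.
  rewrite /e -rowE; apply/matrixP => i j; rewrite !mxE.
  by case: splitP => // k _; rewrite mxE.
have eu' : e^T = gram1 *m u^T by rewrite eu trmx_mul [gram1^T]gram_sym.
have gE H : gram1 *m H *m gram1 = gram1 -> (H *m gram2 *m H) 0 0 = Z 0 0.
  move=> HE.
  have entry (X : 'M[R]_(1 + (2 + 2 * 2))) : X 0 0 = (e *m X *m e^T) 0 0.
    by rewrite /e -rowE trmx_delta -colE !mxE.
  have eH : e *m H *m gram1 = e by rewrite eu -!mulmxA [gram1 *m (H *m _)]mulmxA HE.
  have He : gram1 *m (H *m e^T) = e^T by rewrite eu' !mulmxA HE.
  rewrite entry [RHS]entry A2Z; congr (_ 0 0).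
  by rewrite !mulmxA eH -!mulmxA He.
move=> /gE ->; rewrite /variance_const gE //.
by rewrite mulmxKpV.
Qed.

End Estimator.
End Model.

Definition interpolation_error_variance d (T : measurableType d)
    (R : realType) (P : probability T R) (alphahat : T -> R) (rho_c : R)
    : \bar R :=
  'V_P[fun w => alphahat w - rho_c].

(* The ratio of E x0 to the infimum of E over S tends to 1 along F, without
   dividing by the infimum. *)
Definition asymptotically_minimizes (R : realType) (X : Type)
    (F : set_system R) (S : set X) (E : X -> R -> \bar R) (x0 : X) : Prop :=
  S x0 /\
  forall e : R, 0 < e ->
    \forall s \near F, forall x, S x -> (E x0 s <= (1 + e)%:E * E x s)%E.

Definition noise_sd (R : realType) (snr : R) : R := Num.sqrt (1 / snr).

(* Main.v *)
(** The first order conditions of the weighted least-squares problem give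
    [alphahat = (\sum_k phi_k^2)^-1 \sum_(m, k) w_m phi_k gamma_mk] with
    [w_m = kappa_m (u x_m)] for a row [u] such that [u A1 = (1, 0, ..., 0)], and
    [\sum_m w_m^2 = C]. Since the fadings and the noises are centered,
    independent and Gaussian, the variance of the interpolation error is
    [C (sigma_eta^2 S4 / S2^2 + sigma_eps^2 / S2)], where [S2] and [S4] are the
    sums of the [phi_k^2] and of the [phi_k^4]. By Cauchy-Schwarz
    [S4 / S2^2 >= 1 / K], with equality for the uniform spectrum, while
    [S2 <= (\sum_k phi_k)^2 = K^2], with equality for a single band; the first
    bound decides when [sigma_eps -> 0] and the second when
    [sigma_eps -> +oo]. *)

Require Import Defs.
From mathcomp Require Import ring lra measurable_realfun.

Set Implicit Arguments.
Unset Strict Implicit.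
Unset Printing Implicit Defensive.

Import Order.TTheory GRing.Theory Num.Theory.
Import numFieldNormedType.Exports.
Local Open Scope classical_set_scope.
Local Open Scope ring_scope.

(** * Weighted least squares *)

(** At [t = l / (1 + |a|)] the polynomial equals [l^2 / (1 + |a|)^2 * (a - 1 - |a|)], which is
    negative unless [l = 0], whatever the sign of [a]. *)
Lemma quadratic_ge0_linear_eq0 (R : realFieldType) (a l : R) :
  (forall t : R, 0 <= t ^+ 2 * a - t * l) -> l = 0.
Proof.
move=> h; apply/eqP/negP => /negP l0.
have d0 : 0 < 1 + `|a| by rewrite ltr_pwDl.
have := h (l / (1 + `|a|)).
have -> : (l / (1 + `|a|)) ^+ 2 * a - l / (1 + `|a|) * l =
    l ^+ 2 / (1 + `|a|) ^+ 2 * (a - (1 + `|a|)).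
  by field; rewrite gt_eqF.
rewrite pmulr_rge0; last first.
  by apply: divr_gt0; [rewrite exprn_even_gt0|exact: exprn_gt0].
by rewrite leNgt subr_lt0 (le_lt_trans (ler_norm a))// ltrDr.
Qed.

Section WLS.
Variables (R : realType) (K M : nat).
Variables (kappa : 'cV[R]_2 -> R) (b : R) (z : 'I_M -> 'cV[R]_2) (c : 'cV[R]_2).

Let e : 'rV[R]_(1 + (2 + 2 * 2)) := delta_mx 0 0.
Let x := regressor z c.
Let A1 := gram1 kappa b z c.
Let kw := kernel_weight kappa b z c.

(** The blocks follow the order of [regressor], so that the local polynomial at a sensor is a single
    matrix product. *)
Definition wls_param (alpha : R) (beta : 'cV[R]_2) (B : 'M[R]_2) :
  'rV[R]_(1 + (2 + 2 * 2)) := row_mx alpha%:M (row_mx beta^T (mxvec B)).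

Lemma wls_param_regressor alpha beta B m :
  (wls_param alpha beta B *m x m) 0 0 =
  alpha + (beta^T *m (z m - c)) 0 0 + ((z m - c)^T *m B *m (z m - c)) 0 0.
Proof.
rewrite /wls_param /x /regressor !mul_row_col mulmx1.
rewrite [LHS]mxE [X in _ + X = _]mxE [X in X + _ = _]mxE eqxx mulr1n addrA.
congr (_ + _).
set d := z m - c.
have := mxvec_dotmul B d^T d^T; rewrite !trmxK => <-.
by rewrite !mxE; apply: eq_bigr => j _; rewrite !mxE mulrC.
Qed.

Lemma wls_paramP (theta : 'rV[R]_(1 + (2 + 2 * 2))) :
  exists alpha beta B, theta = wls_param alpha beta B.
Proof.
exists (lsubmx theta 0 0), (lsubmx (rsubmx theta))^T,
  (vec_mx (rsubmx (rsubmx theta))).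
by rewrite /wls_param trmxK vec_mxK -mx11_scalar !hsubmxK.
Qed.

Lemma gram_sym (a : 'I_M -> R) :
  (\sum_m a m *: (x m *m (x m)^T))^T = \sum_m a m *: (x m *m (x m)^T).
Proof.
rewrite linear_sum; apply: eq_bigr => m _.
by rewrite linearZ /= trmx_mul trmxK.
Qed.

(** Serves both Gram matrices: [a = kw] gives [A1], and [a = kw^2] gives [gram2]. *)
Lemma gram_form (a : 'I_M -> R) (u v : 'rV[R]_(1 + (2 + 2 * 2))) :
  (u *m (\sum_m a m *: (x m *m (x m)^T)) *m v^T) 0 0 =
  \sum_m a m * ((u *m x m) 0 0 * (v *m x m) 0 0).
Proof.
rewrite mulmx_sumr mulmx_suml summxE; apply: eq_bigr => m _.
rewrite -scalemxAr -scalemxAl mxE; congr (_ * _).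
have -> : u *m (x m *m (x m)^T) *m v^T = (u *m x m) *m (v *m x m)^T.
  by rewrite trmx_mul !mulmxA.
by rewrite mxE big_ord1 [X in _ * X]mxE.
Qed.

(** Moving from [theta] to [theta + t *: delta] changes the loss by [t^2 Q - t (2 L)], which is
    nonnegative for every [t] at a minimizer; hence [L = 0]. *)
Lemma wls_normal_equation phi (gamma : 'I_M -> 'I_K -> R)
    (theta delta : 'rV[R]_(1 + (2 + 2 * 2))) :
  (forall theta' : 'rV[R]_(1 + (2 + 2 * 2)),
    \sum_m \sum_k (gamma m k - phi k * (theta *m x m) 0 0) ^+ 2 * kw m <=
    \sum_m \sum_k (gamma m k - phi k * (theta' *m x m) 0 0) ^+ 2 * kw m) ->
  \sum_m \sum_k (gamma m k - phi k * (theta *m x m) 0 0) * phi k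
     * (kw m * (delta *m x m) 0 0) = 0.
Proof.
move=> mintheta; set L := (LHS).
pose Q := \sum_m \sum_k (phi k * (delta *m x m) 0 0) ^+ 2 * kw m.
suff: 2 * L = 0 by move/eqP; rewrite mulf_eq0 pnatr_eq0 => /eqP.
apply: (@quadratic_ge0_linear_eq0 _ Q) => t.
have := mintheta (theta + t *: delta); rewrite -subr_ge0; congr (_ <= _).
rewrite /Q /L !mulr_sumr -!sumrB; apply: eq_bigr => m _.
rewrite !mulr_sumr -!sumrB; apply: eq_bigr => k _.
have -> : ((theta + t *: delta) *m x m) 0 0 =
    (theta *m x m) 0 0 + t * (delta *m x m) 0 0.
  by rewrite mulmxDl -scalemxAl mxE [X in _ + X]mxE.
ring.
Qed.

(** This is the normal equation in the direction [u]: as [A1] is symmetric, [A1 u^T = e^T], so the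
    quadratic form of [A1] at the fitted parameter and [u] is the intercept [alpha]. *)
Lemma wls_alphaE phi gamma (alpha : R) u : u *m A1 = e ->
  wls_alpha kappa b z c phi gamma alpha ->
  (\sum_(k < K) phi k ^+ 2) * alpha =
  \sum_m \sum_k phi k * gamma m k * (kw m * (u *m x m) 0 0).
Proof.
move=> uA1 [beta [B minB]].
have := @wls_normal_equation phi gamma (wls_param alpha beta B) u _.
have {}minB (theta' : 'rV[R]_(1 + (2 + 2 * 2))) :
    \sum_m \sum_k
      (gamma m k - phi k * (wls_param alpha beta B *m x m) 0 0) ^+ 2 * kw m <=
    \sum_m \sum_k (gamma m k - phi k * (theta' *m x m) 0 0) ^+ 2 * kw m.
  have [a' [b' [B' ->]]] := wls_paramP theta'.
  move: (minB a' b' B'); rewrite /wls_loss.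
  by congr (_ <= _); apply: eq_bigr => m _; apply: eq_bigr => k _;
    rewrite wls_param_regressor.
move=> /(_ minB) neq.
have uA1' : A1 *m u^T = e^T by rewrite -uA1 trmx_mul /A1 /gram1 gram_sym.
have : (wls_param alpha beta B *m A1 *m u^T) 0 0 = alpha.
  rewrite -mulmxA uA1' /e trmx_delta -colE mxE.
  rewrite /wls_param mxE; case: splitP => // i _.
  by rewrite mxE ord1 eqxx mulr1n.
rewrite /A1 /gram1 gram_form => {1}<-.
rewrite mulr_sumr; apply/eqP; rewrite eq_sym -subr_eq0 -sumrB -[X in _ == X]neq.
apply/eqP/eq_bigr => m _; rewrite mulr_suml -sumrB; apply: eq_bigr => k _.
rewrite -/kw -/(kw m) /=; ring.
Qed.

Hypothesis rk6 : (6 <= \rank A1)%N.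

Lemma delta_sub_gram1 : (e <= A1)%MS.
Proof.
(* The skew matrix [S] yields a row [r] orthogonal to every regressor; by the
   rank hypothesis the row space of [A1] is the hyperplane orthogonal to [r]. *)
pose S : 'M[R]_2 := delta_mx 0 1 - delta_mx 1 0.
pose r : 'rV[R]_(1 + (2 + 2 * 2)) := wls_param 0 0 S.
have r0 : r != 0.
  apply/eqP => r0; have : vec_mx (rsubmx (rsubmx r)) = 0 by rewrite r0 !linear0.
  rewrite /r /wls_param !row_mxKr mxvecK => /matrixP /(_ 0 1).
  by rewrite !mxE /= subr0 => /eqP; rewrite oner_eq0.
have rx m : r *m x m = 0.
  apply/matrixP => i j.
  rewrite !ord1 wls_param_regressor trmx0 mul0mx mxE !add0r.
  set d := z m - c.
  have skew : (d^T *m S *m d)^T = - (d^T *m S *m d).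
    have ST : S^T = - S by rewrite /S [LHS]linearB /= !trmx_delta opprB.
    by rewrite !trmx_mul trmxK ST mulNmx mulmxN mulmxA.
  move/matrixP/(_ 0 0): skew; move: (d^T *m S *m d) => q.
  by rewrite !mxE => qE; lra.
have A1r : A1 *m r^T = 0.
  rewrite -[A1]gram_sym -trmx_mul mulmx_sumr big1 ?trmx0// => m _.
  by rewrite -scalemxAr mulmxA rx mul0mx scaler0.
(* The intercept entry of [r] is 0, so [e] is in the kernel of [r^T]. That kernel has rank
   [7 - 1 = 6] and contains [A1], hence equals its row space. *)
apply: (@submx_trans _ _ _ _ _ _ (kermx r^T)).
  apply/sub_kermxP; rewrite /e -rowE; apply/matrixP => i j.
  rewrite !mxE; case: splitP => // k _.
  by rewrite mxE mul0rn.
rewrite -(geq_leqif (mxrank_leqif_sup _)); last exact/sub_kermxP.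
by rewrite mxrank_ker mxrank_tr rank_rV r0.
Qed.

(** Take [u = e G] with [G] a symmetric generalized inverse of [A1]: the sum of squares is then
    [u A2 u^T], the first diagonal entry of [G A2 G]. *)
Lemma variance_const_weights : exists u, u *m A1 = e /\
  \sum_m (kw m * (u *m x m) 0 0) ^+ 2 = variance_const kappa b z c.
Proof.
have A1T : A1^T = A1 by exact: gram_sym.
have [p pE] : exists p, A1 *m p *m A1 = A1.
  by exists (pinvmx A1); rewrite mulmxKpV.
have pTE : A1 *m p^T *m A1 = A1.
  by have := congr1 trmx pE; rewrite !trmx_mul A1T mulmxA.
(* [variance_constE] allows any generalized inverse; this one is symmetric. *)
pose G := p *m A1 *m p^T.
have GE : A1 *m G *m A1 = A1 by rewrite /G !mulmxA pE pTE.
have GT : G^T = G by rewrite /G !trmx_mul trmxK A1T mulmxA.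
exists (e *m G); split.
  have /submxP[v ev] := delta_sub_gram1.
  by rewrite {1}ev -2!mulmxA [A1 *m _]mulmxA GE -ev.
rewrite -(variance_constE rk6 GE).
transitivity ((e *m G *m gram2 kappa b z c *m (e *m G)^T) 0 0).
  rewrite /gram2 gram_form; apply: eq_bigr => m _.
  by rewrite exprMn [X in _ * X]expr2.
by rewrite trmx_mul GT !mulmxA /e trmx_delta -colE mxE -!mulmxA -rowE mxE !mulmxA.
Qed.

(** If the sum of squares vanished, so would every weight [kw m * (u x_m)], and with them
    [u A1 e^T], which is 1. *)
Lemma variance_const_gt0 : 0 < variance_const kappa b z c.
Proof.
have [u [uA1 <-]] := variance_const_weights.
rewrite lt_neqAle sumr_ge0 ?andbT; last by move=> m _; exact: sqr_ge0.
rewrite eq_sym psumr_neq0; last by move=> m _; exact: sqr_ge0.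
apply/negP => /negP; rewrite -all_predC => /allP w0.
have : (u *m A1 *m e^T) 0 0 = 1.
  by rewrite uA1 /e trmx_delta -colE !mxE !eqxx.
rewrite /A1 /gram1 gram_form big1 => [/eqP|m _]; first by rewrite eq_sym oner_eq0.
have := w0 m (mem_index_enum _).
rewrite /= lt_neqAle sqr_ge0 andbT eq_sym negbK sqrf_eq0.
by move=> /eqP h; rewrite mulrA h mul0r.
Qed.
End WLS.

(** * Moments of the normal law *)

Section Normal.
Context (R : realType) (s : R).
Hypothesis s0 : 0 < s.
Let mu := @lebesgue_measure R.
Let cg : continuous (normal_pdf 0 s).
Proof. by apply: continuous_normal_pdf; rewrite gt_eqF. Qed.

Lemma normal_pdf0E x :
  normal_pdf 0 s x = normal_peak s * expR (- x ^+ 2 / (s ^+ 2 *+ 2)).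
Proof. by rewrite normal_pdfE ?gt_eqF// /normal_fun subr0. Qed.

Lemma normal_pdf_even x : normal_pdf 0 s (- x) = normal_pdf 0 s x.
Proof. by rewrite !normal_pdf0E sqrrN. Qed.

Lemma is_derive_normal_pdf (x : R) :
  is_derive x 1 (normal_pdf 0 s : R -> R) (- (x / s ^+ 2) * normal_pdf 0 s x).
Proof.
have -> : normal_pdf 0 s =
    (fun x => normal_peak s * expR (- x ^+ 2 / (s ^+ 2 *+ 2))).
  by apply/funext => y; exact: normal_pdf0E.
apply: is_derive_eq.
rewrite /GRing.scale /=.
field.
by rewrite gt_eqF.
Qed.

(** With [q = x^2 / (2 s^2)], the bound [exp(-q) <= 1 / q] dominates the function by [k / x]. *)
Lemma cvg_mul_normal_pdf : x * normal_pdf 0 s x @[x --> +oo] --> (0 : R).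
Proof.
pose k := normal_peak s * (s ^+ 2 *+ 2).
apply: (@squeeze_cvgr _ _ _ _ (cst 0) (fun x => k * x^-1)); last 2 first.
- exact: cvg_cst.
- rewrite -[X in _ --> X](mulr0 k); apply: cvgM; first exact: cvg_cst.
  apply/gtr0_cvgV0; first exact: nbhs_pinfty_gt.
  exact: cvg_id.
near=> x; have x0 : 0 < x by near: x; exact: nbhs_pinfty_gt.
rewrite mulr_ge0 ?normal_pdf_ge0 1?(ltW x0)//= normal_pdf0E /k.
rewrite mulrCA -mulrA ler_wpM2l ?normal_peak_ge0//.
have q0 : 0 < x ^+ 2 / (s ^+ 2 *+ 2).
  by rewrite divr_gt0 ?mulrn_wgt0 ?exprn_gt0.
have -> : s ^+ 2 *+ 2 / x = x / (x ^+ 2 / (s ^+ 2 *+ 2)).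
  by field; rewrite !gt_eqF.
rewrite (ler_wpM2l (ltW x0))// mulNr expRN lef_pV2 ?posrE ?expR_gt0//.
by rewrite (le_trans _ (expR_ge1Dx _))// lerDr.
Unshelve. all: by end_near. Qed.

Lemma integral0y_normal_pdf :
  (\int[mu]_(x in `[0%R, +oo[) (normal_pdf 0 s x)%:E = (2^-1)%:E)%E.
Proof.
have := integral_normal_pdf 0 s; rewrite ge0_symfun_integralT.
- rewrite -set_itvcy.
  (* Twice the half-line integral is 1, which also excludes the infinite values. *)
  move: (integral _ _ _) => -[r| |] //=.
  + by rewrite -EFinM => -[r1]; congr EFin; lra.
  + by rewrite gt0_muley ?lte_fin.
  + by rewrite gt0_muleNy ?lte_fin.
- exact: normal_pdf_ge0.
- exact: cg.
- by move=> x /=; rewrite normal_pdf_even.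
Qed.

Let G (x : R) : R := (\int[mu]_(t in `[0, x]) normal_pdf 0 s t)%R.

Let ig A : measurable A -> mu.-integrable A (EFin \o normal_pdf 0 s).
Proof.
move=> mA; apply: (integrableS measurableT) => //.
exact: integrable_normal_pdf.
Qed.

(** [H] is nondecreasing, hence tends to its supremum; along the integers its limit is the integral
    over the half-line, so the supremum is [1/2]. *)
Let cvg_G : G x @[x --> +oo] --> (2^-1 : R).
Proof.
pose H x := (\int[mu]_(t in `[0%R, x]) (normal_pdf 0 s t)%:E)%E.
apply: (@fine_cvg _ _ _ _ H).
have ndH : nondecreasing_fun H.
  move=> x y xy; apply: ge0_subset_integral => //=.
  - by apply/measurable_EFinP/measurable_funTS; exact: measurable_normal_pdf.
  - by move=> t _; rewrite lee_fin normal_pdf_ge0.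
  - by apply: subset_itvl; rewrite bnd_simp.
have Hsup := nondecreasing_cvge ndH.
have Hn : H n%:R @[n --> \oo] --> (2^-1)%:E.
  rewrite -integral0y_normal_pdf; apply: ge0_cvgn_integral.
  - exact: normal_pdf_ge0.
  - exact: measurable_normal_pdf.
have Hn' : H n%:R @[n --> \oo] --> ereal_sup (range H).
  by move/cvge_pinftyP : Hsup; apply; exact/cvgryPge/nbhs_infty_ger.
by rewrite -(cvg_unique _ Hn Hn') in Hsup.
Qed.

Let derive_G (x : R) : 0 < x -> is_derive x 1 G (normal_pdf 0 s x).
Proof.
move=> x0.
have [] := @continuous_FTC1 R (normal_pdf 0 s) (BLeft 0) x (x + 1) _ _ _ _.
- by rewrite ltrDl.
- exact: ig.
- by rewrite lte_fin.
- exact: cg.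
- by move=> dG; rewrite derive1E => <-; exact: DeriveDef.
Qed.

(** Integration by parts: since the density [g] satisfies [g' = -(x / s^2) g], the function
    [s^2 (G - x g)] is a primitive of [x^2 g]; it goes from 0 at 0 to [s^2 / 2] at infinity. *)
Lemma integral0y_sqr_normal_pdf :
  (\int[mu]_(x in `[0%R, +oo[) (x ^+ 2 * normal_pdf 0 s x)%:E =
   (s ^+ 2 / 2)%:E)%E.
Proof.
pose F (x : R) : R := s ^+ 2 * (G x - x * normal_pdf 0 s x).
have dF (x : R) : 0 < x -> is_derive x 1 F (x ^+ 2 * normal_pdf 0 s x).
  move=> x0; have := derive_G x0; have := is_derive_normal_pdf x => dg dG.
  apply: is_derive_eq.
  rewrite /GRing.scale /=; field.
  by rewrite gt_eqF.
(* [derive_G] covers only [x > 0], so right continuity at the endpoint 0 is shown separately. *)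
have cF0 : F x @[x --> 0^'+] --> F 0.
  rewrite /F; apply: cvgM; first exact: cvg_cst.
  apply: cvgB.
    have i01 : mu.-integrable `[0, 1] (EFin \o normal_pdf 0 s) by exact: ig.
    have := parameterized_integral_continuous ler01 i01.
    by move=> /(continuous_within_itvP _ ltr01)[].
  apply: cvgM; apply: cvg_at_right_filter; [exact: cvg_id|exact: cg].
rewrite (@ge0_continuous_FTC2y _ _ F 0 (s ^+ 2 / 2)).
- by rewrite /F /G set_itv1 Rintegral_set1 mul0r subr0 mulr0 sube0.
- by move=> x _; rewrite mulr_ge0 ?sqr_ge0 ?normal_pdf_ge0.
- apply: continuous_subspaceT => x; apply: cvgM; last exact: cg.
  exact: exprn_continuous.
- rewrite /F -(subr0 2^-1); apply: cvgM; first exact: cvg_cst.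
  by apply: cvgB; [exact: cvg_G|exact: cvg_mul_normal_pdf].
- by move=> x x0; have := dF x x0 => ?; exact: ex_derive.
- exact: cF0.
- by move=> x; rewrite in_itv/= andbT => /dF ?; rewrite derive1E derive_val.
Qed.

Lemma integral_sqr_normal_pdf :
  (\int[mu]_x (x ^+ 2 * normal_pdf 0 s x)%:E = (s ^+ 2)%:E)%E.
Proof.
rewrite ge0_symfun_integralT.
- by rewrite -set_itvcy integral0y_sqr_normal_pdf -EFinM; congr EFin; field.
- by move=> x; rewrite mulr_ge0 ?sqr_ge0 ?normal_pdf_ge0.
- by move=> x; apply: cvgM; [exact: exprn_continuous|exact: cg].
- by move=> x /=; rewrite normal_pdf_even sqrrN.
Qed.

(** By evenness the left side is twice its half-line part, where [|x|] is [max x 0]. This reduces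
    the centering of the law to integrals of nonnegative functions. *)
Lemma integral_abs_normal_pdf :
  (\int[mu]_x (`|x| * normal_pdf 0 s x)%:E =
   2%:E * \int[mu]_x (Num.max x 0 * normal_pdf 0 s x)%:E)%E.
Proof.
rewrite ge0_symfun_integralT.
- congr (_ * _)%E; rewrite -set_itvcy integral_mkcond; apply: eq_integral => x _.
  rewrite patchE; have [x0|x0] := leP 0 x.
    by rewrite mem_set/= ?in_itv/= ?andbT// ger0_norm.
  by rewrite memNset/= ?in_itv/= ?leNgt ?x0// mul0r.
- by move=> x; rewrite mulr_ge0 ?normal_pdf_ge0.
- by move=> x; apply: cvgM; [exact: norm_continuous|exact: cg].
- by move=> x /=; rewrite normal_pdf_even normrN.
Qed.

(** The Radon-Nikodym derivative of the normal law agrees almost everywhere with the density, both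
    having the same integral over each measurable set. *)
Lemma ge0_integral_normal_prob (f : R -> \bar R) :
  measurable_fun [set: R] f -> (forall x, 0 <= f x)%E ->
  (\int[normal_prob 0%R s]_x f x = \int[mu]_x (f x * (normal_pdf 0 s x)%:E))%E.
Proof.
move=> mf f0.
pose nu : {finite_measure set _ -> \bar R} := normal_prob 0 s.
have dom : nu `<< mu by exact: normal_prob_dominates.
rewrite -(Radon_Nikodym_SigmaFinite.change_of_variables dom f0 measurableT mf).
apply: ae_eq_integral => //.
- apply: emeasurable_funM => //.
  exact: measurable_int (Radon_Nikodym_SigmaFinite.f_integrable dom).
- apply: emeasurable_funM => //; apply/measurable_EFinP.
  exact: measurable_normal_pdf.
- apply: ae_eqe_mul2l; apply: integral_ae_eq => //=.
  + exact: Radon_Nikodym_SigmaFinite.f_integrable.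
  + by apply/measurable_EFinP; exact: measurable_normal_pdf.
  + by move=> E _ mE; rewrite -Radon_Nikodym_SigmaFinite.f_integral.
Qed.

Section RV.
Context d (T : measurableType d) (P : probability T R) (X : {RV P >-> R}).
Hypothesis normalX : forall A : set R, measurable A ->
  distribution P X A = normal_prob 0 s A.

Lemma ge0_expectation_normal (f : R -> R) : measurable_fun [set: R] f ->
  (forall x, 0 <= f x) ->
  'E_P[f \o X]%E = (\int[mu]_x (f x * normal_pdf 0 s x)%:E)%E.
Proof.
move=> mf f0; rewrite unlock.
rewrite -[LHS]/(\int[P]_w ((EFin \o f) \o X) w)%E.
have mEf : measurable_fun [set: R] (EFin \o f) by exact/measurable_EFinP.
(* The normal law lives on [measurableTypeR R], which has the measurable sets of
   [R] but is another [measurableType]. *)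
have mXR : measurable_fun [set: T] X by exact: measurable_funPT.
have mX : @measurable_fun _ _ T (measurableTypeR R) setT X by exact: mXR.
rewrite -(@ge0_integral_pushforward _ _ T (measurableTypeR R) R X mX P setT)//;
  last first.
  by move=> x _; rewrite lee_fin f0.
rewrite (eq_measure_integral (normal_prob 0 s)); last first.
  by move=> A mA _; exact: normalX.
by rewrite ge0_integral_normal_prob.
Qed.

Lemma normal_Lfun2 : (X : T -> R) \in Lfun P 2%:E.
Proof.
have mX : measurable_fun [set: T] X by exact: measurable_funPT.
rewrite inE; apply/andP; split; rewrite inE//=.
rewrite /finite_norm unlock poweR_lty//.
have := @ge0_expectation_normal (fun x => x ^+ 2) _ (fun x => sqr_ge0 x).
rewrite integral_sqr_normal_pdf unlock => E2.
under eq_integral => x _.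
  rewrite [(`|_|)%E]/= -[2]/(2%:R) poweR_EFin powR_mulrn// -normrX.
  rewrite ger0_norm ?sqr_ge0//.
  over.
by rewrite [ltLHS]E2 ?ltry.
Qed.

Lemma expectation_normal : 'E_P[X]%E = 0%E.
Proof.
have Pfin : P setT \is a fin_num := fin_num_measure P _ measurableT.
have X1 : (X : T -> R) \in Lfun P 1 := Lfun_subset12 Pfin normal_Lfun2.
(* By parity [`|X|] has twice the expectation of the positive part of [X]. *)
pose Xp := (fun x : R => Num.max x 0) \o X.
have EabsX : 'E_P[Num.Def.normr \o X]%E = (2%:E * 'E_P[Xp])%E.
  rewrite ge0_expectation_normal// integral_abs_normal_pdf.
  rewrite ge0_expectation_normal//.
  - exact: measurable_maxr.
  - by move=> x; rewrite le_max lexx orbT.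
have aX1 : Num.Def.normr \o X \in Lfun P 1 by exact: Lfun_norm.
have -> : (X : T -> R) = (2 \o* Xp \- (Num.Def.normr \o X))%R.
  apply/funext => w; rewrite /= /Xp /=; case: (leP (X w) 0) => Xw.
    by rewrite ler0_norm//; lra.
  by rewrite gtr0_norm//; lra.
have Xp1 : Xp \in Lfun P 1.
  have -> : Xp = (2^-1 \o* (X \+ (Num.Def.normr \o X)))%R.
    apply/funext => w /=; rewrite /= /Xp /=; case: (leP (X w) 0) => Xw.
      by rewrite ler0_norm//; lra.
    by rewrite gtr0_norm//; lra.
  by apply: Lfun_scale => //; rewrite rpredD.
rewrite expectationB//; last exact: Lfun_scale.
by rewrite expectationZl// EabsX subee// fin_numM// expectation_fin_num.
Qed.

Lemma variance_normal : 'V_P[X]%E = (s ^+ 2)%:E.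
Proof.
rewrite varianceE ?normal_Lfun2// expectation_normal expe2 mule0 sube0.
rewrite -integral_sqr_normal_pdf -(@ge0_expectation_normal (fun x => x ^+ 2))//.
by move=> x; exact: sqr_ge0.
Qed.
End RV.
End Normal.

(** * Variance of sums of independent variables *)

Section Indep.
Local Open Scope ereal_scope.
Context d (T : measurableType d) (R : realType) (P : probability T R).

(** Independence says that the law of the pair agrees with the product of the marginal laws on
    rectangles, hence everywhere; Fubini then factors the integral of [x y]. *)
Lemma expectation_mul_indep (X Y : {RV P >-> R}) :
  (forall A B : set R, measurable A -> measurable B ->
    P (X @^-1` A `&` Y @^-1` B) = P (X @^-1` A) * P (Y @^-1` B)) ->
  (X : T -> R) \in Lfun P 1 -> (Y : T -> R) \in Lfun P 1 ->
  (X \* Y)%R \in Lfun P 1 ->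
  'E_P[(X \* Y)%R] = 'E_P[X] * 'E_P[Y].
Proof.
move=> indepXY X1 Y1 XY1.
have iX : P.-integrable setT (EFin \o X) by exact/Lfun1_integrable.
have iY : P.-integrable setT (EFin \o Y) by exact/Lfun1_integrable.
have iXY : P.-integrable setT (EFin \o (X \* Y)%R) by exact/Lfun1_integrable.
pose XY (w : T) : R * R := (X w, Y w).
have mXY : measurable_fun [set: T] XY.
  by apply/measurable_fun_pairP; split => /=; exact: measurable_funPT.
pose f (p : R * R) : \bar R := (p.1 * p.2)%:E.
have mf : measurable_fun setT f.
  by apply/measurable_EFinP; exact: measurable_funM.
pose PX : probability _ R := distribution P X.
pose PY : probability _ R := distribution P Y.
have prodE A : measurable A -> (PX \x PY) A = pushforward P XY A.
  move=> mA.
  exact: (@product_measure_unique _ _ _ _ R PX PY (pushforward P XY)).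
have fXY : f \o XY = EFin \o (X \* Y)%R by [].
have ipf : (pushforward P XY).-integrable setT f.
  by apply: integrable_pushforward => //; rewrite preimage_setT fXY.
have ipr : (PX \x PY).-integrable setT f.
  apply/integrableP; split => //; have /integrableP[_] := ipf.
  rewrite [X in _ -> X < _](eq_measure_integral (pushforward P XY))// => A mA _.
  exact: prodE.
transitivity (\int[PX \x PY]_p f p).
  rewrite (eq_measure_integral (pushforward P XY)); last first.
    by move=> A mA _; exact: prodE.
  rewrite integral_pushforward//.
  by rewrite unlock.
rewrite -integral12_prod_meas1// /fubini_F /=.
have iPX : PX.-integrable setT EFin.
  by apply: integrable_pushforward => //; rewrite preimage_setT.
have iPY : PY.-integrable setT EFin.
  by apply: integrable_pushforward => //; rewrite preimage_setT.
have EX : \int[PX]_x x%:E = 'E_P[X].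
  by rewrite integral_distribution// unlock.
have EY : \int[PY]_x x%:E = 'E_P[Y].
  by rewrite integral_distribution// unlock.
under eq_integral => x _.
  rewrite /f /=; under eq_integral do rewrite EFinM.
  rewrite integralZl// EY.
  over.
have Yfin : 'E_P[Y] \is a fin_num by exact: expectation_fin_num.
by rewrite -(fineK Yfin) integralZr// EX.
Qed.

Lemma covariance_indep (X Y : {RV P >-> R}) :
  (forall A B : set R, measurable A -> measurable B ->
    P (X @^-1` A `&` Y @^-1` B) = P (X @^-1` A) * P (Y @^-1` B)) ->
  (X : T -> R) \in Lfun P 2%:E -> (Y : T -> R) \in Lfun P 2%:E ->
  covariance P X Y = 0.
Proof.
move=> indepXY X2 Y2.
have Pfin : P setT \is a fin_num := fin_num_measure P _ measurableT.
have X1 := Lfun_subset12 Pfin X2.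
have Y1 := Lfun_subset12 Pfin Y2.
have XY1 := Lfun2_mul_Lfun1 X2 Y2.
rewrite covarianceE// expectation_mul_indep// subee// fin_numM//.
  exact: expectation_fin_num.
exact: expectation_fin_num.
Qed.

Lemma covariance_mutually_independent
    (I : finType) (X : I -> {RV P >-> R}) i j :
  mutually_independent P (fun i w => X i w) -> i != j ->
  (X i : T -> R) \in Lfun P 2%:E -> (X j : T -> R) \in Lfun P 2%:E ->
  covariance P (X i) (X j) = 0.
Proof.
move=> indep ij; apply: covariance_indep => A B mA mB.
(* With the whole line at every other index, the product rule keeps only the factors at [i] and
   [j]. *)
pose S k := if k == i then A else if k == j then B else setT.
have mS k : measurable (S k) by rewrite /S; case: ifP => // _; case: ifP.
have := indep S mS.
rewrite (bigD1 i)//= (bigD1 j)/=; last by rewrite eq_sym.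
rewrite big1 ?mule1 => [|k /andP[ki kj]]; last first.
  by rewrite /S (negbTE ki) (negbTE kj) preimage_setT probability_setT.
rewrite /S eqxx eq_sym (negbTE ij) eqxx => <-; congr (P _).
apply/seteqP; split => [w [/= Aw Bw] k|w /= Sw]; last first.
  split; first by have := Sw i; rewrite eqxx.
  by have := Sw j; rewrite eq_sym (negbTE ij) eqxx.
by case: eqP => [->//|_]; case: eqP => [->|].
Qed.

Lemma Lfun_sum (I : Type) (s : seq I) (X : I -> T -> R) (p : \bar R) : 1 <= p ->
  (forall i, X i \in Lfun P p) -> (fun w => \sum_(i <- s) X i w)%R \in Lfun P p.
Proof.
move=> p1 Xp; rewrite (_ : (fun w => _) = (\sum_(i <- s) X i)%R); last first.
  by apply/funext => w; rewrite fct_sumE.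
by rewrite rpred_sum.
Qed.

Lemma covariance_sumr (I : Type) (s : seq I) (X : T -> R) (Y : I -> T -> R) :
  X \in Lfun P 2%:E -> (forall i, Y i \in Lfun P 2%:E) ->
  covariance P X (fun w => \sum_(i <- s) Y i w)%R =
  \sum_(i <- s) covariance P X (Y i).
Proof.
move=> X2 Y2; elim: s => [|i s IH].
  rewrite big_nil; under eq_fun do rewrite big_nil.
  exact: covariance_cst_r.
rewrite big_cons -IH -covarianceDr//; last first.
  by apply: Lfun_sum => //; rewrite lee1n.
by congr covariance; apply/funext => w; rewrite big_cons.
Qed.

Lemma variance_sum_uncorrelated (I : eqType) (s : seq I) (Y : I -> T -> R) :
  uniq s ->
  (forall i, Y i \in Lfun P 2%:E) ->
  (forall i j, i != j -> covariance P (Y i) (Y j) = 0) ->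
  'V_P[(fun w => \sum_(i <- s) Y i w)%R] = \sum_(i <- s) 'V_P[Y i].
Proof.
move=> us Y2 Y0; elim: s us => [_|i s IH /= /andP[si us]].
  rewrite big_nil; under eq_fun do rewrite big_nil.
  exact: variance_cst.
have S2 : (fun w => \sum_(j <- s) Y j w)%R \in Lfun P 2%:E.
  by apply: Lfun_sum => //; rewrite lee1n.
rewrite big_cons -IH//.
rewrite [X in variance _ X]
  (_ : _ = Y i \+ (fun w => \sum_(j <- s) Y j w))%R; last first.
  by apply/funext => w; rewrite big_cons.
(* The list has no repetition, so the head is uncorrelated with each term of the tail. *)
rewrite varianceD// covariance_sumr// big_seq big1 ?mule0 ?adde0// => j js.
by apply: Y0; apply: contraNneq si => ->.
Qed.

Lemma variance_lincomb_independent
    (I : finType) (X : I -> {RV P >-> R}) (a : I -> R) :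
  mutually_independent P (fun i w => X i w) ->
  (forall i, (X i : T -> R) \in Lfun P 2%:E) ->
  'V_P[(fun w => \sum_i a i * X i w)%R] = \sum_i (a i ^+ 2)%:E * 'V_P[X i].
Proof.
move=> indep X2.
have aX i : (fun w => a i * X i w)%R = (a i \o* X i)%R.
  by apply/funext => w /=; rewrite mulrC.
have Y2 i : (fun w => a i * X i w)%R \in Lfun P 2%:E.
  by rewrite aX; apply: Lfun_scale => //; rewrite ler1n.
have Pfin : P setT \is a fin_num := fin_num_measure P _ measurableT.
rewrite (@variance_sum_uncorrelated _ _ (fun i w => a i * X i w)%R)//.
- by apply: eq_bigr => i _; rewrite aX varianceZ.
- exact: index_enum_uniq.
- move=> i j ij; rewrite !aX covarianceZl ?covarianceZr//=.
  all: rewrite ?covariance_mutually_independent ?mule0//.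
  all: rewrite ?Lfun_scale// ?Lfun2_mul_Lfun1//.
  all: try exact: (Lfun_subset12 Pfin (X2 _)).
  by rewrite Lfun_scale// ler1n.
Qed.
End Indep.

(** * Power spectra *)

Section Spectrum.
Variables (R : realType) (K : nat).
Implicit Type phi : 'I_K -> R.

(** Allows dividing by the sum of squares when solving for [alphahat]. *)
Lemma spectrum_sumsq_gt0 phi : (0 < K)%N -> spectrum phi ->
  0 < \sum_k phi k ^+ 2.
Proof.
move=> K0 [_ phiK]; rewrite lt_neqAle sumr_ge0 ?andbT; last first.
  by move=> k _; exact: sqr_ge0.
apply/eqP => /esym/eqP.
rewrite psumr_eq0 => [/allP phi0|k _]; last exact: sqr_ge0.
have : \sum_k phi k = 0.
  apply: big1 => k _; have := phi0 k (mem_index_enum _).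
  by rewrite /= sqrf_eq0 => /eqP.
by rewrite phiK => /eqP; rewrite pnatr_eq0 eqn0Ngt K0.
Qed.

(** Each power is at most the total, so [phi_k^2 <= phi_k * \sum_j phi_j]. *)
Lemma spectrum_sumsq_le phi : spectrum phi -> \sum_k phi k ^+ 2 <= K%:R ^+ 2.
Proof.
move=> [phi0 phiK]; rewrite -phiK [leRHS]expr2 mulr_suml; apply: ler_sum => k _.
rewrite expr2 ler_wpM2l// (bigD1 k)//= lerDl sumr_ge0// => i _; exact: phi0.
Qed.

(** Cauchy-Schwarz through Lagrange's identity: the sum of all [(a_i - a_j)^2] is twice the
    difference of the two sides. *)
Lemma sqr_sum_le (a : 'I_K -> R) : (\sum_k a k) ^+ 2 <= K%:R * \sum_k a k ^+ 2.
Proof.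
have : 0 <= \sum_i \sum_j (a i - a j) ^+ 2.
  by apply: sumr_ge0 => i _; apply: sumr_ge0 => j _; exact: sqr_ge0.
have -> : \sum_i \sum_j (a i - a j) ^+ 2 =
    2 * (K%:R * \sum_k a k ^+ 2 - (\sum_k a k) ^+ 2).
  under eq_bigr => i _.
    under eq_bigr do rewrite sqrrB.
    rewrite big_split sumrB /= sumr_const card_ord sumrMnl -mulr_sumr.
    over.
  rewrite big_split sumrB /= sumr_const card_ord !sumrMnl -mulr_suml.
  rewrite -(mulr_natl (\sum_k a k ^+ 2) K).
  by ring.
by rewrite pmulr_rge0// subr_ge0.
Qed.

Lemma uniform_spectrumP : spectrum (@uniform_spectrum R K).
Proof. by split=> [k|]; rewrite ?ler01// sumr_const card_ord. Qed.

(** The exponent is a successor because [0 ^+ 0 = 1] would make the empty bands count. *)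
Lemma single_band_sumX n : (0 < K)%N ->
  \sum_k @single_band_spectrum R K k ^+ n.+1 = K%:R ^+ n.+1.
Proof.
move=> K0; rewrite (bigD1 (Ordinal K0))//= big1 ?addr0// => k k0.
rewrite /single_band_spectrum ifF ?expr0n//; apply/negbTE.
by apply: contraNneq k0 => k0; apply/eqP/val_inj.
Qed.

Lemma single_band_spectrumP : (0 < K)%N -> spectrum (@single_band_spectrum R K).
Proof.
move=> K0; split=> [k|]; first by rewrite /single_band_spectrum; case: ifP.
by have := single_band_sumX 0 K0; under eq_bigr do rewrite expr1.
Qed.
End Spectrum.

(** * Closed form of the error variance and its two asymptotic regimes *)

Lemma sum_sum_pair (V : nmodType) (I J : finType) (F : I * J + I * J -> V) :
  \sum_i F i = \sum_i \sum_j (F (inl (i, j)) + F (inr (i, j))).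
Proof.
rewrite big_sumType pair_bigA big_split /=.
by congr (_ + _); apply: eq_bigr => -[i j] _.
Qed.

Theorem corollary1
  (R : realType) (d : measure_display) (T : measurableType d)
  (P : probability T R)
  (K M : nat) (K_gt0 : (0 < K)%N)
  (D : set 'cV[R]_2) (D_bounded : bounded_set D)
  (z : 'I_M -> 'cV[R]_2) (z_in : forall m, D (z m))
  (c : 'cV[R]_2) (c_in : D c)
  (kappa : 'cV[R]_2 -> R) (b : R) (b_gt0 : 0 < b)
  (A1_nondegenerate : (6 <= \rank (gram1 kappa b z c))%N)
  (rho : 'cV[R]_2 -> R)
  (sigma_eta : R) (sigma_eta_gt0 : 0 < sigma_eta)
  (eta : 'I_K -> 'cV[R]_2 -> {RV P >-> R})
  (eta_normal : forall k x, D x -> forall A : set R, measurable A ->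
     distribution P (eta k x) A = normal_prob 0 sigma_eta A)
  (power_smooth : forall phi, spectrum phi ->
     {ae P, forall w, forall (k : 'I_K) x, D x ->
        third_order_differentiable
          (band_power rho (fun k' y => eta k' y w) phi k) x})
  (eps : R -> 'I_M -> 'I_K -> {RV P >-> R})
  (eps_normal : forall sigma_eps, 0 < sigma_eps -> forall m k,
     forall A : set R, measurable A ->
     distribution P (eps sigma_eps m k) A = normal_prob 0 sigma_eps A)
  (indep : forall sigma_eps, 0 < sigma_eps ->
     mutually_independent P
       (fading_and_noise (fun k x w => eta k x w)
                         (fun m k w => eps sigma_eps m k w) z))
  (alphahat : ('I_K -> R) -> R -> T -> R)
  (alphahat_wls : forall phi sigma_eps w, spectrum phi -> 0 < sigma_eps ->
     wls_alpha kappa b z c phi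
       (measurement rho (fun k x => eta k x w)
                    (fun m k => eps sigma_eps m k w) z phi)
       (alphahat phi sigma_eps w)) :
  let C := variance_const kappa b z c in
  let Et (phi : 'I_K -> R) (snr : R) :=
    interpolation_error_variance P (alphahat phi (noise_sd snr)) (rho c) in
  (asymptotically_minimizes +oo (@spectrum R K) Et (@uniform_spectrum R K) /\
   Et (@uniform_spectrum R K) snr @[snr --> +oo]
     --> (C * sigma_eta ^+ 2 / K%:R)%:E) /\
  (asymptotically_minimizes 0^'+ (@spectrum R K) Et
     (@single_band_spectrum R K) /\
   (Et (@single_band_spectrum R K) snr
      * ((C * noise_sd snr ^+ 2 / K%:R ^+ 2)^-1)%:E)%E @[snr --> 0^'+]
     --> 1%:E).
move=> C Et.
have C0 : 0 < C by exact: variance_const_gt0.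
have K0 : 0 < K%:R :> R by rewrite ltr0n.
(* Here [snr^-1] is the noise variance [sigma_eps^2]. *)
pose V (phi : 'I_K -> R) (snr : R) : R :=
  C * (sigma_eta ^+ 2 * (\sum_k phi k ^+ 4) / (\sum_k phi k ^+ 2) ^+ 2
       + snr^-1 / \sum_k phi k ^+ 2).
have EtE phi (snr : R) : spectrum phi -> 0 < snr -> Et phi snr = (V phi snr)%:E.
  move=> sphi snr0.
  have S2 := spectrum_sumsq_gt0 K_gt0 sphi.
  have sd0 : 0 < noise_sd snr by rewrite sqrtr_gt0 divr_gt0.
  have sd2 : noise_sd snr ^+ 2 = snr^-1.
    by rewrite sqr_sqrtr ?div1r// invr_ge0 ltW.
  have [u [uA1]] := variance_const_weights A1_nondegenerate.
  pose wt m := kernel_weight kappa b z c m * (u *m regressor z c m) 0 0.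
  rewrite -/(\sum_m wt m ^+ 2) -/C => uC.
  pose X (i : 'I_M * 'I_K + 'I_M * 'I_K) : {RV P >-> R} :=
    match i with
    | inl (m, k) => eta k (z m)
    | inr (m, k) => eps (noise_sd snr) m k
    end.
  pose S := \sum_k phi k ^+ 2; rewrite -/S in S2.
  have S0 : S != 0 by rewrite gt_eqF.
  (* The measurement already carries the fading with a factor [phi_k], and the estimator multiplies
     by [phi_k] again; the noise gets only the second factor. *)
  pose a (i : 'I_M * 'I_K + 'I_M * 'I_K) : R :=
    match i with
    | inl (m, k) => wt m * phi k ^+ 2 / S
    | inr (m, k) => wt m * phi k / S
    end.
  (* The deterministic part of the error, that is its bias, which does not affect the variance. *)
  pose c0 := (\sum_m \sum_k wt m * phi k ^+ 2 * rho (z m)) / S - rho c.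
  have Xindep : mutually_independent P (fun i w => X i w).
    move=> A mA; have := indep _ sd0 A mA; congr (P _ = _).
      by apply/seteqP; split => w h [[m k]|[m k]];
        [exact: (h (inl (m, k)))|exact: (h (inr (m, k)))
        |exact: (h (inl (m, k)))|exact: (h (inr (m, k)))].
    by apply: eq_bigr => -[[m k]|[m k]] _.
  have X2 i : (X i : T -> R) \in Lfun P 2%:E.
    case: i => -[m k].
      by apply: (normal_Lfun2 sigma_eta_gt0); exact: eta_normal.
    by apply: (normal_Lfun2 sd0); exact: eps_normal.
  have VX i : 'V_P[X i]%E =
      (if i is inl _ then sigma_eta ^+ 2 else snr^-1)%:E.
    case: i => -[m k].
      by apply: (variance_normal sigma_eta_gt0); exact: eta_normal.
    by rewrite -sd2; apply: (variance_normal sd0); exact: eps_normal.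
  have alphaE : (fun w => alphahat phi (noise_sd snr) w - rho c) =
      (cst c0 \+ (fun w => \sum_i a i * X i w))%R.
    apply/funext => w /=.
    have := wls_alphaE uA1 (alphahat_wls phi _ w sphi sd0).
    rewrite -/S => /(canRL (mulKf S0)) ->.
    rewrite sum_sum_pair /= /c0 addrAC; congr (_ - _).
    rewrite mulrC !mulr_suml -big_split; apply: eq_bigr => m _ /=.
    rewrite !mulr_suml -big_split; apply: eq_bigr => k _ /=.
    by rewrite /measurement /band_power /wt; field.
  rewrite /Et /interpolation_error_variance alphaE varianceD_cst_l; last first.
    apply: Lfun_sum => [|i]; first by rewrite lee1n.
    rewrite (_ : (fun w => _) = a i \o* X i)%R.
      by rewrite Lfun_scale// ler1n.
    by apply/funext => w /=; rewrite mulrC.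
  rewrite variance_lincomb_independent//.
  under eq_bigr => i _ do rewrite VX -EFinM.
  rewrite sumEFin sum_sum_pair /V -uC mulr_suml /=; congr EFin.
  apply: eq_bigr => m _.
  (* For fixed [m], summing over [k] turns the fading terms into the sum of fourth powers and the
     noise terms into [S], one factor of which cancels. *)
  transitivity (\sum_k (wt m ^+ 2 * sigma_eta ^+ 2 / S ^+ 2 * phi k ^+ 4 +
                        wt m ^+ 2 / snr / S ^+ 2 * phi k ^+ 2)).
    by apply: eq_bigr => k _; field; rewrite S0 gt_eqF.
  rewrite big_split -!mulr_sumr /= -/S.
  by field; rewrite S0 gt_eqF.
have VuE (snr : R) : V (@uniform_spectrum R K) snr =
    C * (sigma_eta ^+ 2 / K%:R + snr^-1 / K%:R).
  rewrite /V /uniform_spectrum; under eq_bigr do rewrite expr1n.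
  under [X in _ / X ^+ 2]eq_bigr do rewrite expr1n.
  under [X in _^-1 / X]eq_bigr do rewrite expr1n.
  rewrite sumr_const card_ord; congr (_ * (_ + _)).
  by field; rewrite gt_eqF.
(* Here the sums of squares and of fourth powers are [K^2] and [K^4], so the fading factor is 1. *)
have VsE (snr : R) : V (@single_band_spectrum R K) snr =
    C * (sigma_eta ^+ 2 + snr^-1 / K%:R ^+ 2).
  rewrite /V !single_band_sumX//; congr (_ * (_ + _)).
  by field; rewrite gt_eqF.
(* Drop the noise term and apply [sqr_sum_le] to the squares [phi_k^2]. *)
have Vge_fading phi (snr : R) : spectrum phi -> 0 < snr ->
    C * (sigma_eta ^+ 2 / K%:R) <= V phi snr.
  move=> sphi snr0; have S2 := spectrum_sumsq_gt0 K_gt0 sphi.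
  rewrite ler_pM2l// ler_wpDr//; first by rewrite divr_ge0 ?invr_ge0// ltW.
  rewrite -mulrA ler_pM2l ?exprn_gt0// ler_pdivlMr ?exprn_gt0//.
  rewrite mulrC ler_pdivrMr// mulrC.
  have := sqr_sum_le (fun k => phi k ^+ 2).
  by under [X in K%:R * X]eq_bigr do rewrite -exprM.
(* Drop the fading term and bound the sum of squares by [K^2]. *)
have Vge_noise phi (snr : R) : spectrum phi -> 0 < snr ->
    C * (snr^-1 / K%:R ^+ 2) <= V phi snr.
  move=> sphi snr0; have S2 := spectrum_sumsq_gt0 K_gt0 sphi.
  rewrite ler_pM2l// ler_wpDl//.
    rewrite divr_ge0 ?sqr_ge0// mulr_ge0 ?sqr_ge0// sumr_ge0// => k _.
    by rewrite exprn_even_ge0.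
  rewrite ler_pM2l ?invr_gt0// lef_pV2 ?posrE ?exprn_gt0//.
  exact: spectrum_sumsq_le.
have uP := @uniform_spectrumP R K.
have sP := single_band_spectrumP R K_gt0.
split; split.
- split=> // e e0; near=> snr => phi sphi.
  have snr0 : 0 < snr by near: snr; exact: nbhs_pinfty_gt.
  rewrite !EtE// -EFinM lee_fin.
  (* The noise term of the uniform spectrum fits in the slack [e] once [snr^-1 <= e * sigma_eta^2],
     a threshold independent of [phi]. *)
  apply: (@le_trans _ _ ((1 + e) * (C * (sigma_eta ^+ 2 / K%:R)))).
    rewrite VuE mulrCA ler_pM2l// mulrDl mul1r lerD2l mulrA ler_pM2r ?invr_gt0//.
    rewrite -[leRHS]invrK lef_pV2 ?posrE ?invr_gt0 ?mulr_gt0 ?exprn_gt0//.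
  by rewrite ler_pM2l ?addr_gt0//; exact: Vge_fading.
- apply: (@cvg_trans _ ((C * (sigma_eta ^+ 2 / K%:R + snr^-1 / K%:R))%:E
      @[snr --> +oo])).
    apply: near_eq_cvg; near=> snr.
    have snr0 : 0 < snr by near: snr; exact: nbhs_pinfty_gt.
    by rewrite EtE// VuE.
  apply: cvg_EFin; first exact: nearW.
  have -> : C * sigma_eta ^+ 2 / K%:R = C * (sigma_eta ^+ 2 / K%:R + 0 / K%:R).
    by rewrite mul0r addr0 mulrA.
  apply: cvgM; first exact: cvg_cst.
  apply: cvgD; first exact: cvg_cst.
  apply: cvgM; last exact: cvg_cst.
  by apply/gtr0_cvgV0; [exact: nbhs_pinfty_gt|exact: cvg_id].
- split=> // e e0; near=> snr => phi sphi.
  have snr0 : 0 < snr by near: snr; exact: nbhs_right_gt.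
  rewrite !EtE// -EFinM lee_fin.
  (* The fading term of the single band fits in the slack [e] once
     [snr <= e / (K^2 sigma_eta^2)]. *)
  apply: (@le_trans _ _ ((1 + e) * (C * (snr^-1 / K%:R ^+ 2)))).
    rewrite VsE mulrCA ler_pM2l// mulrDl mul1r addrC lerD2l.
    have -> : e * (snr^-1 / K%:R ^+ 2) = (e / K%:R ^+ 2) / snr.
      by field; rewrite !gt_eqF.
    rewrite ler_pdivlMr// mulrC -ler_pdivlMr ?exprn_gt0//.
    by near: snr; apply: nbhs_right_le; rewrite !divr_gt0 ?exprn_gt0.
  by rewrite ler_pM2l ?addr_gt0//; exact: Vge_noise.
(* Both the variance and [C sigma_eps^2 / K^2] diverge, so their ratio is studied; it is exactly
   [1 + sigma_eta^2 K^2 snr] for [snr > 0]. *)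
- apply: (@cvg_trans _ ((1 + sigma_eta ^+ 2 * K%:R ^+ 2 * snr)%:E
      @[snr --> 0^'+])).
    apply: near_eq_cvg; near=> snr.
    have snr0 : 0 < snr by near: snr; exact: nbhs_right_gt.
    rewrite EtE// VsE -EFinM; congr EFin.
    rewrite sqr_sqrtr ?divr_ge0 ?ltW//.
    by field; rewrite !gt_eqF.
  apply: cvg_EFin; first exact: nearW.
  pose k := sigma_eta ^+ 2 * K%:R ^+ 2.
  have : 1 + k * snr @[snr --> 0^'+] --> 1 + k * 0.
    apply: cvgD; first exact: cvg_cst.
    apply: cvgM; first exact: cvg_cst.
    exact/cvg_at_right_filter/cvg_id.
  by rewrite mulr0 addr0.
Unshelve. all: by end_near. Qed.
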